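(* Let $a,b$ be relatively prime positive integers with $a<b$, and suppose that if $a=1$ then $b$ is even. Consider the subtraction game $\mathcal{S}(a,b)$. If $a+1<b\le 2a$, then the subtraction set $\{a,b\}$ has expansion $\{a,a+1,\ldots,b\}^{*(a+b)}$. If either $a=1$, or $b=a+1$, or $b>2a$, then the subtraction set $\{a,b\}$ is non-expandable.
   Context: For a finite set $S=\{s_1<\cdots<s_k\}$ of positive integers, the subtraction game $\mathcal{S}(S)=\mathcal{S}(s_1,\ldots,s_k)$ is played on a single pile of coins: two players alternately remove $s\in S$ coins (with $s$ at most the pile size); the player making the last move wins. The nim-value of a pile of $n$ coins is $\mathcal{G}(n)=\operatorname{mex}\{\mathcal{G}(n-s): s\in S,\ s\le n\}$, and $(\mathcal{G}(n))_{n\ge 0}$ is the nim-sequence. The game is ultimately periodic with period $p$ and pre-period $n_0$ if $\mathcal{G}(n+p)=\mathcal{G}(n)$ for all $n\ge n_0$, with $p$ and $n_0$ the least such; it is periodic if $n_0=0$. (For $\mathcal{S}(a,b)$ as in the claim, the game is periodic with period $a+b$.) The expansion of $S$ is $S^{ex}=\{s\ge 1 : \mathcal{G}(n+s)\ne\mathcal{G}(n)\text{ for all } n\ge 0\}$ (the positive integers that can be added to $S$ without changing the nim-sequence); ''the subtraction set has expansion $T$'' means $S^{ex}=T$. For a set $X$ of positive integers and $p\ge1$, $X^{*p}=\{x+mp: x\in X, m\ge 0\}$. The subtraction set $S$ is non-expandable if $S^{ex}=S$ or $S^{ex}=S^{*p}$, where $p$ is the period of $\mathcal{S}(S)$. 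*)

(* Defs.v *)
From mathcomp Require Import all_boot.
From mathcomp Require Import finmap.
From mathcomp Require Import classical_sets.

Set Implicit Arguments.
Unset Strict Implicit.
Unset Printing Implicit Defensive.

Local Open Scope classical_set_scope.

Lemma mex_subproof (s : seq nat) : exists n, n \notin s.
Proof.
have le_sumn y : y \in s -> y <= sumn s.
  elim: s => //= z s IHs; rewrite inE => /predU1P[->|/IHs le_ys].
    exact: leq_addr.
  exact: leq_trans le_ys (leq_addl _ _).
by exists (sumn s).+1; apply/negP => /le_sumn; rewrite ltnn.
Qed.

Definition mex (s : seq nat) : nat := ex_minn (mex_subproof s).

(* [nim_prefix S n] is the list G(0), ..., G(n-1); this course-of-values form
   turns the recursion for G into a structural one (see [nim_valueE]). *)
Fixpoint nim_prefix (S : {fset nat}) (n : nat) : seq nat :=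
  if n is m.+1 then
    let r := nim_prefix S m in
    rcons r (mex [seq nth 0 r (m - s) | s <- S & s <= m])
  else [::].

Definition nim_value (S : {fset nat}) (n : nat) : nat :=
  nth 0 (nim_prefix S n.+1) n.

Lemma size_nim_prefix (S : {fset nat}) n : size (nim_prefix S n) = n.
Proof. by elim: n => //= n IHn; rewrite size_rcons IHn. Qed.

Lemma nth_nim_prefix (S : {fset nat}) n i :
  i < n -> nth 0 (nim_prefix S n) i = nim_value S i.
Proof.
elim: n => // n IHn; rewrite ltnS leq_eqVlt => /predU1P[->//|lt_in].
by rewrite /= nth_rcons size_nim_prefix lt_in IHn.
Qed.

Lemma nim_valueE (S : {fset nat}) n : 0 \notin S ->
  nim_value S n = mex [seq nim_value S (n - s) | s <- S & s <= n].
Proof.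
move=> S0; rewrite {1}/nim_value /= nth_rcons size_nim_prefix ltnn eqxx.
congr mex; apply/eq_in_map => s; rewrite mem_filter => /andP[le_sn sS].
have s_gt0 : 0 < s by case: s sS {le_sn} => // sS; rewrite sS in S0.
by rewrite nth_nim_prefix // ltn_subrL s_gt0 (leq_trans s_gt0).
Qed.

Definition ultimately_periodic (S : {fset nat}) (p n0 : nat) : Prop :=
  forall n, n0 <= n -> nim_value S (n + p) = nim_value S n.

Definition is_period (S : {fset nat}) (p : nat) : Prop :=
  [/\ 0 < p, exists n0, ultimately_periodic S p n0
    & forall q n0, 0 < q -> ultimately_periodic S q n0 -> p <= q].

Definition expansion (S : {fset nat}) : set nat :=
  [set s | 0 < s /\ forall n, nim_value S (n + s) <> nim_value S n].

(* X^{*p} *)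
Definition star (X : set nat) (p : nat) : set nat :=
  [set x + m * p | x in X & m in [set: nat]].

Definition non_expandable (S : {fset nat}) : Prop :=
  expansion S = [set` S] \/
  exists2 p, is_period S p & expansion S = star [set` S] p.

(* Main.v *)
Require Import Defs.
From mathcomp Require Import all_boot.
From mathcomp Require Import finmap.
From mathcomp Require Import classical_sets.
From mathcomp Require Import zify.

(** Write [p = a + b].  The nim-sequence is the [p]-periodic sequence that
    alternates blocks [0^a 1^a 0^a ...], except that a [0] at a position
    [>= b] of the period is replaced by a [2].  Membership of [c] in the
    expansion depends only on [c mod p] and is invariant under [c |-> p - c].
    Since the period starts with [0^a], a residue [c < b] is excluded as soon as
    adding it takes some [x < a] to another [0].  If [c < a], or if [c] lies in
    an even block, [x = 0] does; if [c] lies in an odd block but is not a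
    multiple of [a], then some [x < a] goes to the start of the next block.
    When [b > 2 a] these rules, applied to [c] and to [p - c], exclude
    everything but [a] and [b].
    Finally, an ultimate period [q] makes [a + q] and [b + q] members of the
    expansion, which forces [p] to divide [q] unless [b = 3 a]. *)

Local Open Scope classical_set_scope.

Lemma mex_eq (s : seq nat) m :
  m \notin s -> (forall i, i < m -> i \in s) -> mex s = m.
Proof.
move=> ms lts; rewrite /mex; case: ex_minnP => n ns minn.
apply/eqP; rewrite eqn_leq minn //= leqNgt.
by apply/negP => /lts; rewrite (negPf ns).
Qed.

Definition block_value (a b x : nat) : nat :=
  if odd (x %/ a) then 1 else if b <= x then 2 else 0.

Definition block_seq (a b n : nat) : nat := block_value a b (n %% (a + b)).

Lemma block_value_small a b x : a < b -> x < a -> block_value a b x = 0.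
Proof. by move=> ab xa; rewrite /block_value divn_small // leqNgt (ltn_trans xa ab). Qed.

Lemma block_value_even a b x :
  x < b -> ~~ odd (x %/ a) -> block_value a b x = 0.
Proof. by move=> xb /negPf ex; rewrite /block_value ex leqNgt xb. Qed.

Lemma odd_divnDr a x : 0 < a -> odd ((x + a) %/ a) = ~~ odd (x %/ a).
Proof. by move=> a0; rewrite divnDr ?dvdnn // divnn a0 addn1. Qed.

Lemma odd_divnBr a x : 0 < a -> a <= x -> odd ((x - a) %/ a) = ~~ odd (x %/ a).
Proof. by move=> a0 ax; rewrite -{2}(subnK ax) odd_divnDr // negbK. Qed.

Lemma block_seq_mod a b n : block_seq a b (n %% (a + b)) = block_seq a b n.
Proof. by rewrite /block_seq modn_mod. Qed.

Lemma block_seqDmod a b n c :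
  block_seq a b (n + c %% (a + b)) = block_seq a b (n + c).
Proof. by rewrite /block_seq modnDmr. Qed.

Lemma block_seqDp a b n k : block_seq a b (n + k * (a + b)) = block_seq a b n.
Proof. by rewrite /block_seq addnC modnMDl. Qed.

Lemma block_seq_small a b x : x < a + b -> block_seq a b x = block_value a b x.
Proof. by move=> xp; rewrite /block_seq modn_small. Qed.

Lemma block_seq_wrap a b x :
  a + b <= x < (a + b).*2 -> block_seq a b x = block_value a b (x - (a + b)).
Proof.
move=> /andP[px x2p]; rewrite -(subnK px) -{2}[a + b]mul1n block_seqDp.
by rewrite addnK block_seq_small //; lia.
Qed.

(** Below [b], adding [a] flips the parity of the block; from [b] on, where the value is 1 or 2, it
    wraps into the first block, where the value is 0. *)
Lemma block_seqDa a b n : 0 < a < b -> block_seq a b (n + a) <> block_seq a b n.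
Proof.
move=> /andP[a0 ab].
have xp : n %% (a + b) < a + b by rewrite ltn_mod; lia.
rewrite -(block_seq_mod a b n) -(block_seq_mod a b (n + a)) -modnDml block_seq_mod.
move: (n %% (a + b)) xp => x xp; rewrite (block_seq_small _ _ x) //.
have [xb|bx] := ltnP x b.
  rewrite block_seq_small ?(addnC a b) ?ltn_add2r // /block_value.
  rewrite odd_divnDr // [b <= x]leqNgt xb.
  by case: odd => //=; case: ifP.
rewrite block_seq_wrap; last by lia.
rewrite block_value_small //; last by lia.
by rewrite /block_value bx; case: odd.
Qed.

(** Modulo [a + b], adding [b] undoes adding [a]. *)
Lemma block_seqDb a b n : 0 < a < b -> block_seq a b (n + b) <> block_seq a b n.
Proof.
move=> ab; rewrite -[in X in _ <> X](block_seqDp a b n 1) mul1n (addnC a) addnA.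
by move=> /esym; apply: block_seqDa.
Qed.

Lemma nim_valueE_block a b n :
  0 < a < b -> nim_value [fset a; b]%fset n = block_seq a b n.
Proof.
move=> /[dup] ab' /andP[a0 ab]; elim/ltn_ind: n => n IHn.
have sub s : s \in [fset a; b]%fset -> s <= n ->
    nim_value [fset a; b]%fset (n - s) = block_seq a b (n - s).
  by rewrite !inE => /orP[]/eqP-> le_sn; apply: IHn; lia.
rewrite nim_valueE; last by rewrite !inE; lia.
apply: mex_eq.
  apply/mapP => -[s]; rewrite mem_filter => /andP[le_sn sS].
  rewrite sub // -{1}(subnK le_sn).
  by move: sS; rewrite !inE => /orP[]/eqP->; [apply: block_seqDa|apply: block_seqDb].
have le_xn : n %% (a + b) <= n by apply: leq_mod.
have seqB s : s <= n %% (a + b) ->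
    block_seq a b (n - s) = block_value a b (n %% (a + b) - s).
  move=> sx; rewrite {1}(divn_eq n (a + b)) -addnBA // addnC block_seqDp.
  by rewrite block_seq_small // ltn_subLR // ltn_addl // ltn_mod; lia.
have xp : n %% (a + b) < a + b by rewrite ltn_mod; lia.
have mem s : s \in [fset a; b]%fset -> s <= n %% (a + b) ->
    block_value a b (n %% (a + b) - s) \in
    [seq nim_value [fset a; b]%fset (n - s) | s <- [fset a; b]%fset & s <= n].
  move=> sS sx; have le_sn := leq_trans sx le_xn.
  by rewrite -seqB // -sub //; apply: map_f; rewrite mem_filter le_sn.
have mema := mem a (fset21 _ _); have memb := mem b (fset22 _ _).
rewrite /block_seq; move: (n %% (a + b)) xp mema memb => x xp mema memb.
(* Smaller values are reached within the period: from a 1, removing [a] gives 0; from a 2, removing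
   [b] lands in the first block, giving 0, and removing [a] gives 1. *)
case: {2 3}(block_value a b x) (erefl (block_value a b x)) => // v.
rewrite /block_value; case: ifP => [ox [<-]|ex].
  move=> [|//] _; have ax : a <= x.
    by rewrite leqNgt; apply/negP => xa; rewrite divn_small in ox.
  by move: (mema ax); rewrite block_value_even ?odd_divnBr ?ox //; lia.
case: ifP => // bx [<-] [|[|//]] _.
  by move: (memb bx); rewrite block_value_small //; lia.
have ax : a <= x by lia.
by move: (mema ax); rewrite /block_value odd_divnBr // ex.
Qed.

Lemma in_expansion a b s : 0 < a < b ->
  expansion [fset a; b]%fset s <->
  forall n, block_seq a b (n + s) <> block_seq a b n.
Proof.
move=> ab; split=> [[_ gs] n|gs]; first by rewrite -!nim_valueE_block.
split=> [|n]; last by rewrite !nim_valueE_block.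
by rewrite lt0n; apply/eqP => s0; apply: (gs 0); rewrite s0.
Qed.

Lemma expansion_eq_star a b (X : set nat) : 0 < a < b ->
  (forall c, X c -> c < a + b /\ forall n, block_seq a b (n + c) <> block_seq a b n) ->
  (forall c, c < a + b -> ~ X c -> exists n, block_seq a b (n + c) = block_seq a b n) ->
  expansion [fset a; b]%fset = star X (a + b).
Proof.
move=> ab Xexp Xhit; apply/seteqP; split=> s /=.
  move=> /(in_expansion _ _ _ ab) gs.
  exists (s %% (a + b)); last first.
    by exists (s %/ (a + b)) => //; rewrite addnC -divn_eq.
  have [//|nX] := boolp.pselect (X (s %% (a + b))).
  have [|n] := Xhit _ _ nX; first by rewrite ltn_mod; lia.
  by rewrite block_seqDmod => /gs.
move=> [c /Xexp[_ gc] [m _ <-]]; apply/(in_expansion _ _ _ ab) => n.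
by rewrite addnA block_seqDp.
Qed.

(** Both [x] and [y] carry the value 0. The second alternative says [y = x + (p - c)] and serves the
    rules applied to [p - c]. *)
Lemma hit_zero a b c x y : 0 < a < b -> x < a -> y < b -> ~~ odd (y %/ a) ->
  y = x + c \/ y + c = x + (a + b) ->
  exists n, block_seq a b (n + c) = block_seq a b n.
Proof.
move=> /andP[a0 ab] xa yb ey.
have gx : block_seq a b x = 0.
  by rewrite block_seq_small ?block_value_small //; lia.
have gy : block_seq a b y = 0.
  by rewrite block_seq_small ?block_value_even //; lia.
case=> e; first by exists x; rewrite -e gx gy.
by exists y; rewrite e -[a + b]mul1n block_seqDp gx gy.
Qed.

Lemma hit_outside a b c : 0 < a < b -> c < a + b -> ~~ (a <= c <= b) ->
  exists n, block_seq a b (n + c) = block_seq a b n.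
Proof.
move=> ab cp; rewrite negb_and -!ltnNge => /orP[ca|bc].
  by apply: (@hit_zero a b c 0 c) => //; [lia|lia|rewrite divn_small|left].
apply: (@hit_zero a b c 0 (a + b - c)) => //; [lia|lia| |right; lia].
by rewrite divn_small //; lia.
Qed.

Lemma hit_inside a b c : 0 < a -> coprime a b -> (a = 1 -> ~~ odd b) ->
  2 * a < b -> a < c < b ->
  exists n, block_seq a b (n + c) = block_seq a b n.
Proof.
move=> a0 co even_b a2b acb; have ab : 0 < a < b by lia.
have [oj|ej] := boolP (odd (c %/ a)); last first.
  by apply: (@hit_zero a b c 0 c) => //; [lia|left].
have ec := divn_eq c a; have eb := divn_eq b a.
have ta : c %% a < a by rewrite ltn_mod.
have ra : b %% a < a by rewrite ltn_mod.
have [t0|t_gt0] := posnP (c %% a).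
  set j := c %/ a in oj ec; set k := b %/ a in eb; set r := b %% a in eb ra.
  (* [j] is odd, and [j = 1] would give [c = a]. *)
  have j3 : 3 <= j by case: (j) oj ec => [|[|[|]]] //; lia.
  have jk : j <= k by rewrite leq_div2r //; lia.
  have ejk : k * a = (k - j) * a + j * a by rewrite -mulnDl subnK.
  have [ok|ek] := boolP (odd k); last first.
    (* For even [k], [p - c] itself lies in the even block [k - j + 1]. *)
    apply: (@hit_zero a b c 0 (a + b - c)) => //; [lia| |right; lia].
    have -> : a + b - c = (k - j).+1 * a + r by rewrite mulSn; lia.
    by rewrite divnMDl // (divn_small ra) addn0 /= oddB // oj (negPf ek).
  have r_gt0 : 0 < r.
    rewrite lt0n; apply/negP => /dvdnP[m bm].
    have a1 : a = 1 by move: co; rewrite bm coprimeMr => /andP[_]; rewrite /coprime gcdnn => /eqP.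
    by move: (even_b a1); rewrite -[b]divn1 -{1}a1 -/k ok.
  (* For odd [k], [p - c] is [r] past the start of the odd block [k - j + 1], so adding [a - r]
     reaches the next block; [j >= 3] keeps its start below [b]. *)
  apply: (@hit_zero a b c (a - r) ((k - j).+2 * a)) => //; [lia| | |right].
  - have : 3 * a <= j * a by rewrite leq_mul2r j3 orbT.
    by rewrite !mulSn; lia.
  - by rewrite mulnK //= negbK oddB // oj ok.
  - by rewrite !mulSn; lia.
have [lt_jb|le_bj] := ltnP ((c %/ a).+1 * a) b.
  apply: (@hit_zero a b c (a - c %% a) ((c %/ a).+1 * a)) => //; [lia| |left].
  - by rewrite mulnK //= negbK.
  - by rewrite mulSn; lia.
(* The next block starts too late, so [b - c < a]: now [p - c] lies in block 1, and adding
   [a + c - b] reaches [2 * a < b]. *)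
apply: (@hit_zero a b c (a + c - b) (2 * a)) => //; last by right; lia.
- by rewrite mulSn in le_bj; lia.
- by rewrite mulnK.
Qed.

(** One period is now [0^a 1^a 2^(b-a)], with runs of length at most [a]. Both [c] and [p - c] are
    at least [a], so the shift by [c] leaves every run. *)
Lemma expansion_interval a b : 0 < a < b -> b <= 2 * a ->
  expansion [fset a; b]%fset = star [set c : nat | a <= c <= b] (a + b).
Proof.
move=> ab b2a; apply: expansion_eq_star => // c /=; last first.
  by move=> cp /negP; apply: hit_outside.
move=> acb; split=> [|n]; first by lia.
have val x : x < a + b -> block_value a b x =
    if x < a then 0 else if x < a + a then 1 else 2.
  move=> xp; case: ltnP => ax; first by rewrite block_value_small //; lia.
  have a0 : 0 < a by lia.
  have [x2|x2] := ltnP x (a + a).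
    have : odd ((x - a) %/ a) = false by rewrite divn_small //; lia.
    by rewrite odd_divnBr // /block_value => /negbFE ->.
  have : odd ((x - a - a) %/ a) = false by rewrite divn_small //; lia.
  rewrite !odd_divnBr ?negbK; [|lia..].
  by rewrite /block_value => ->; rewrite ifT //; lia.
rewrite -(block_seq_mod a b n) -(block_seq_mod a b (n + c)) -modnDml block_seq_mod.
have xp : n %% (a + b) < a + b by rewrite ltn_mod; lia.
move: (n %% (a + b)) xp => x xp; rewrite (block_seq_small _ _ x) // val //.
have [xcp|pxc] := ltnP (x + c) (a + b).
  by rewrite block_seq_small // val //; do !case: ifP; lia.
rewrite block_seq_wrap; last by lia.
by rewrite val; [do !case: ifP; lia|lia].
Qed.

Lemma is_period_of_expansion a b : 0 < a < b -> coprime a b ->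
  (a = 1 -> ~~ odd b) ->
  expansion [fset a; b]%fset = star [set` [fset a; b]%fset] (a + b) ->
  is_period [fset a; b]%fset (a + b).
Proof.
move=> ab co even_b expE; split; first by lia.
  by exists 0 => n _; rewrite !nim_valueE_block // -[a + b]mul1n block_seqDp.
move=> q n0 q0 qper; rewrite leqNgt; apply/negP => qp.
(* Translating by [n0] full periods [a + b] passes the pre-period. *)
have gq n : block_seq a b (n + q) = block_seq a b n.
  rewrite -(block_seqDp a b (n + q) n0) -(block_seqDp a b n n0) addnAC.
  rewrite -!nim_valueE_block // qper //.
  by rewrite (leq_trans _ (leq_addl _ _)) // leq_pmulr //; lia.
have mem s : s \in [fset a; b]%fset ->
    exists2 x, x = a \/ x = b & exists m, x + m * (a + b) = s + q.
  move=> sS; have : expansion [fset a; b]%fset (s + q).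
    apply/(in_expansion _ _ _ ab) => n; rewrite addnA gq.
    by move: sS; rewrite !inE => /orP[]/eqP->; [apply: block_seqDa|apply: block_seqDb].
  rewrite expE => -[x /= xS [m _ e]]; exists x; last by exists m.
  by move: xS; rewrite !inE => /orP[]/eqP->; [left|right].
have [x xE [m em]] := mem a (fset21 _ _).
have [y yE [l el]] := mem b (fset22 _ _).
(* As [0 < q < a + b], [a + q] is congruent to [b] and [b + q] to [a], which forces [q = b - a] and
   [q = 2 * a]. *)
have b3a : b = 3 * a.
  case: xE yE em el => -> [] ->; case: m l => [|[|m]] [|[|l]]; rewrite ?mulSn; lia.
have a1 : a = 1 by move: co; rewrite b3a coprimeMr => /andP[_]; rewrite /coprime gcdnn => /eqP.
by move: (even_b a1); rewrite b3a a1.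
Qed.

Theorem theorem2p1 (a b : nat) (a_gt0 : 0 < a) (lt_ab : a < b)
    (co_ab : coprime a b) (even_b : a = 1 -> ~~ odd b) :
  (a + 1 < b /\ b <= 2 * a ->
     expansion [fset a; b]%fset = star [set c : nat | a <= c <= b] (a + b)) /\
  (a = 1 \/ b = a + 1 \/ 2 * a < b ->
     non_expandable [fset a; b]%fset).
Proof.
have ab : 0 < a < b by rewrite a_gt0.
split=> [[_ b2a]|cases]; first exact: expansion_interval.
suff expE : expansion [fset a; b]%fset = star [set` [fset a; b]%fset] (a + b).
  by right; exists (a + b) => //; apply: is_period_of_expansion.
apply: expansion_eq_star => // c /=; rewrite !inE.
  by move=> /orP[]/eqP->; split=> [|n]; [lia|exact: block_seqDa|lia|exact: block_seqDb].
move=> cp /negP; rewrite negb_or => cab.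
have [acb|] := boolP (a <= c <= b); last exact: hit_outside.
(* If [b = a + 1], no [c] lies strictly between [a] and [b]; if [a = 1], either [b = 2] is that case
   or [b > 2 * a]. *)
by apply: hit_inside => //; case: cases => [a1|[]]; try lia.
Qed.
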